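(* Let $\varphi\in(0,\pi/2]$. The system of nonlinear equations $$\psi_{3,0}(t_1)=0,\qquad \psi_{3,0}(t_2)=0,\qquad t_1=2-\sqrt{3},\quad t_2=\sqrt{3}-1,$$ in the unknowns $(\xi,\eta)$ has a unique admissible solution $(\xi^*,\eta^* )$, i.e. a unique solution in $\mathcal{D}_{3,0}:=\{(\xi,\eta)\in\mathbb{R}^2:\ \xi>1,\ \eta>0\}$. Consequently, there exists a unique cubic $G^0$ approximant $\boldsymbol{p}_3^*$ of the circular arc $\boldsymbol{c}$ that is of the form $\boldsymbol{p}_3$ with $(\xi,\eta)\in\mathcal{D}_{3,0}$ and for which $\psi_{3,0}=C\,p_{6,0}^*$ for some nonzero constant $C\in\mathbb{R}$. The error of the approximation, measured by $\psi_{3,0}^*(t)=\|\boldsymbol{p}_3^*(t)\|_2^2-1$, is $$\max_{t\in[-1,1]}\left|\psi_{3,0}^*(t)\right|=\frac{1}{64}\left(26-15\sqrt{3}\right)\varphi^6+\mathcal{O}(\varphi^8)\approx 0.0003\,\varphi^6+\mathcal{O}(\varphi^8)\qquad(\varphi\to0^+).$$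
   Context: For $0<\varphi\le\pi/2$ the circular arc is $\boldsymbol{c}:[-\varphi,\varphi]\to\mathbb{R}^2$, $\boldsymbol{c}(s)=(\cos s,\sin s)^T$. For $(\xi,\eta)\in\mathbb{R}^2$ let $\boldsymbol{p}_3:[-1,1]\to\mathbb{R}^2$ be the cubic parametric polynomial curve $$\boldsymbol{p}_3(t)=\sum_{j=0}^3 B_j^3(t)\,\boldsymbol{b}_j,\qquad B_j^3(t)=\binom{3}{j}\left(\frac{1+t}{2}\right)^{j}\left(\frac{1-t}{2}\right)^{3-j},$$ with control points $$\boldsymbol{b}_0=(\cos\varphi,-\sin\varphi)^T,\quad \boldsymbol{b}_1=(\xi,-\eta)^T,\quad \boldsymbol{b}_2=(\xi,\eta)^T,\quad \boldsymbol{b}_3=(\cos\varphi,\sin\varphi)^T.$$ A $G^0$ approximant is one that interpolates the boundary points of the arc, i.e. $\boldsymbol{p}_3(\pm1)=\boldsymbol{c}(\pm\varphi)$; every curve of this form is a $G^0$ approximant. The (simplified, signed) radial error is $$\psi_{3,0}(t)=\|\boldsymbol{p}_3(t)\|_2^2-1,\qquad t\in[-1,1],$$ with $\|\cdot\|_2$ the Euclidean norm; it depends on $\xi,\eta,\varphi$. The polynomial $$p_{6,0}^*(t)=(1-t^2)(t^2-t_1^2)(t^2-t_2^2)$$ with $t_1=2-\sqrt3$, $t_2=\sqrt3-1$ is the polynomial of minimal max norm on $[-1,1]$ among all polynomials $(1-t^2)q(t)$ with $q$ monic of degree $4$. The curve $\boldsymbol{p}_3^*$ is $\boldsymbol{p}_3$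 with $(\xi,\eta)=(\xi^*,\eta^* )$, and $\psi_{3,0}^*$ is the corresponding $\psi_{3,0}$.
   Formalization: The printed constant 1/64 is false for the error ‖p‖²−1; the formal theorem proves 1/32 there instead, and proves the printed constant 1/64 (≈0.0003) for the maximum of the unsquared radial error |‖p‖−1|. *)

(* Defs.v *)
(* Library world: Stdlib reals with Coquelicot. *)
From Stdlib Require Import Reals.
From Coquelicot Require Import Coquelicot.
Open Scope R_scope.

Definition arc (s : R) : R * R := (cos s, sin s).

(* [Binomial.C] is the real-valued binomial coefficient; Coquelicot's [C] is
   the type of complex numbers. *)
Definition bernstein (n j : nat) (t : R) : R :=
  Binomial.C n j * ((1 + t) / 2) ^ j * ((1 - t) / 2) ^ (n - j).

(* [q] is the pair of unknowns (xi, eta). *)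
Definition control_point (phi : R) (q : R * R) (j : nat) : R * R :=
  match j with
  | 0%nat => (cos phi, - sin phi)
  | 1%nat => (fst q, - snd q)
  | 2%nat => (fst q, snd q)
  | _ => (cos phi, sin phi)
  end.

(* Curves on [-1, 1] are encoded as functions on R; only their values on
   [-1, 1] matter.  [sum_n u 3] has the four terms u 0, ..., u 3. *)
Definition cubic (phi : R) (q : R * R) (t : R) : R * R :=
  sum_n (fun j => scal (bernstein 3 j t) (control_point phi q j)) 3.

(* The norm of Coquelicot's normed module R * R is the Euclidean one,
   sqrt (|x| ^ 2 + |y| ^ 2). *)
Definition psi (p : R -> R * R) (t : R) : R := norm (p t) ^ 2 - 1.

(* Since psi = (norm - 1) * (norm + 1), psi is close to twice this quantity
   when the curve is close to the unit circle. *)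
Definition radial_distance (p : R -> R * R) (t : R) : R := norm (p t) - 1.

Definition t1 : R := 2 - sqrt 3.
Definition t2 : R := sqrt 3 - 1.

Definition p60 (t : R) : R :=
  (1 - t ^ 2) * (t ^ 2 - t1 ^ 2) * (t ^ 2 - t2 ^ 2).

Definition domain_D (q : R * R) : Prop := 1 < fst q /\ 0 < snd q.

Definition admissible_solution (phi : R) (q : R * R) : Prop :=
  domain_D q /\ psi (cubic phi q) t1 = 0 /\ psi (cubic phi q) t2 = 0.

Definition G0_interpolates (phi : R) (p : R -> R * R) : Prop :=
  p (-1) = arc (- phi) /\ p 1 = arc phi.

Definition optimal_G0_approximant (phi : R) (p : R -> R * R) : Prop :=
  (exists q : R * R,
     domain_D q /\ forall t, -1 <= t <= 1 -> p t = cubic phi q t) /\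
  G0_interpolates phi p /\
  (exists c : R, c <> 0 /\ forall t, -1 <= t <= 1 -> psi p t = c * p60 t).

Definition is_max_on (f : R -> R) (a b m : R) : Prop :=
  (exists t, a <= t <= b /\ f t = m) /\ (forall t, a <= t <= b -> f t <= m).

Definition bigO_right0 (f g : R -> R) : Prop :=
  exists K : R, at_right 0 (fun x => Rabs (f x) <= K * Rabs (g x)).

(* Main.v *)
Require Import Defs.
From Stdlib Require Import Reals ClassicalEpsilon Lra.
From Coquelicot Require Import Coquelicot.
Open Scope R_scope.

(** Write [c = cos phi], [s = sin phi] and [w = 1 - t ^ 2].  The cubic curve is
    the point [(c, t * s)] of the chord plus a multiple of [w]:
      [x = c + a * w],  [y = t * (s + b * w)],
    where [(a, b)] is an affine change of the unknowns [(xi, eta)].  Hence the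
    error [psi] is [w] times a quadratic polynomial in [w] with leading
    coefficient [- b ^ 2].  It vanishes at [t1] and [t2] exactly when this
    quadratic is [- b ^ 2] times the monic one with the roots [1 - t1 ^ 2] and
    [1 - t2 ^ 2], and then [psi = - b ^ 2 * p60].  Comparing coefficients gives
      [a ^ 2 = 2 * s * b + kappa * b ^ 2],
      [2 * a * c = s ^ 2 - 2 * s * b - mu * b ^ 2]
    with two small positive constants [kappa] and [mu] ([coefficient_system]).

    On the admissible domain [a > 0] and [b > - s / 4], so the first equation forces
    [b > 0].  For [a, b > 0] the first equation makes [a] an increasing function
    of [b], while the second makes [a * c] a decreasing one, so there is at most
    one solution ([system_unique]); the intermediate value theorem on
    [0 <= b <= s / 2] gives one ([system_exists]).  The condition [xi > 1] holds
    because with [a <= 3 / 4 * (1 - c)] both unknowns are too small for the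
    second equation ([system_xi_gt_1]).

    A curve whose error is a multiple of [p60] has zeros of the error at [t1]
    and [t2], so uniqueness of the approximant is uniqueness of the admissible
    solution.

    The maximum of [|p60|] on [[-1, 1]] is [p60 0 = 2 * (26 - 15 * sqrt 3)], the
    equioscillation value of a cubic Chebyshev polynomial in [w]; so the maximum
    of [|psi|] is [b ^ 2] times this number.  As [psi] is extremal with negative
    sign at [t = 0], and [x |-> sqrt (1 + x)] is concave, the radial distance is
    extremal there too.  Finally the system gives successively
      [2 * a = s ^ 2 + O(s ^ 4)],  [8 * b = s ^ 3 + O(s ^ 5)],
      [64 * b ^ 2 = s ^ 6 + O(s ^ 8)],
    and [sin phi ^ 6 = phi ^ 6 + O(phi ^ 8)] yields the asymptotic constants. *)

(** * The error as a polynomial in 1 - t ^ 2 *)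

(** The coefficients of [1 - t ^ 2] in the two coordinates; see
    [cubic_coordinates]. *)
Definition bulge_x (phi : R) (q : R * R) : R := 3 / 4 * (fst q - cos phi).
Definition bulge_y (phi : R) (q : R * R) : R := (3 * snd q - sin phi) / 4.

Lemma cubic_coordinates (phi : R) (q : R * R) (t : R) :
  cubic phi q t =
  (cos phi + bulge_x phi q * (1 - t ^ 2), t * (sin phi + bulge_y phi q * (1 - t ^ 2))).
Proof.
  destruct q as [xi eta]; unfold cubic, bernstein, bulge_x, bulge_y.
  rewrite !sum_Sn, sum_O.
  assert (HC0 : Binomial.C 3 0 = 1) by (unfold Binomial.C; simpl; field).
  assert (HC1 : Binomial.C 3 1 = 3) by (unfold Binomial.C; simpl; field).
  assert (HC2 : Binomial.C 3 2 = 3) by (unfold Binomial.C; simpl; field).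
  assert (HC3 : Binomial.C 3 3 = 1) by (unfold Binomial.C; simpl; field).
  rewrite HC0, HC1, HC2, HC3.
  cbn -[cos sin pow].
  apply injective_projections; cbn -[cos sin]; field.
Qed.

Lemma norm_pair_sqr (p : R * R) : norm p ^ 2 = fst p ^ 2 + snd p ^ 2.
Proof.
  destruct p as [x y].
  change (norm (x, y)) with (sqrt (Rabs x ^ 2 + Rabs y ^ 2)).
  rewrite pow2_sqrt, !pow2_abs; [reflexivity|].
  apply Rplus_le_le_0_compat; apply pow2_ge_0.
Qed.

Lemma cos2_plus_sin2 (phi : R) : cos phi ^ 2 + sin phi ^ 2 = 1.
Proof. pose proof (sin2_cos2 phi); unfold Rsqr in *; lra. Qed.

Lemma psi_cubic (phi : R) (q : R * R) (t : R) :
  let c := cos phi in let s := sin phi in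
  let a := bulge_x phi q in let b := bulge_y phi q in let w := 1 - t ^ 2 in
  psi (cubic phi q) t =
  w * ((2 * a * c + 2 * s * b - s ^ 2) + (a ^ 2 - 2 * s * b + b ^ 2) * w
       - b ^ 2 * w ^ 2).
Proof.
  intros c s a b w; unfold psi.
  rewrite norm_pair_sqr, cubic_coordinates; cbn [fst snd].
  fold c s a b w.
  assert (H : c ^ 2 = 1 - s ^ 2)
    by (pose proof (cos2_plus_sin2 phi); unfold c, s; lra).
  assert (Ht : t ^ 2 = 1 - w) by (unfold w; ring).
  rewrite Rpow_mult_distr, Ht.
  ring_simplify. rewrite H. ring.
Qed.

(** * The equations for the two unknowns *)

Lemma sqrt3_bounds : 1.732 < sqrt 3 < 1.7321.
Proof.
  split.
  - apply Rsqr_incrst_0; [|lra|apply sqrt_pos].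
    rewrite Rsqr_sqrt; unfold Rsqr; lra.
  - apply Rsqr_incrst_0; [|apply sqrt_pos|lra].
    rewrite Rsqr_sqrt; unfold Rsqr; lra.
Qed.

Lemma sqrt3_sqr : sqrt 3 * sqrt 3 = 3.
Proof. apply sqrt_sqrt; lra. Qed.

(** With [w1 = 1 - t1 ^ 2] and [w2 = 1 - t2 ^ 2], the constants are
    [kappa = w1 + w2 - 1] and [mu = w1 * w2]. *)
Definition kappa : R := 6 * sqrt 3 - 10.
Definition mu : R := 42 - 24 * sqrt 3.

Lemma kappa_bounds : 0 < kappa < 1 / 2.
Proof. unfold kappa; pose proof sqrt3_bounds; lra. Qed.

Lemma mu_bounds : 0 < mu < 1 / 2.
Proof. unfold mu; pose proof sqrt3_bounds; lra. Qed.

Definition coefficient_system (c s a b : R) : Prop :=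
  a ^ 2 = 2 * s * b + kappa * b ^ 2 /\
  2 * a * c = s ^ 2 - 2 * s * b - mu * b ^ 2.

Lemma p60_in_w (t : R) :
  p60 t = (1 - t ^ 2) * ((1 - t ^ 2) ^ 2 - (kappa + 1) * (1 - t ^ 2) + mu).
Proof.
  unfold p60, t1, t2, kappa, mu.
  pose proof sqrt3_sqr as H; set (r := sqrt 3) in *.
  replace ((2 - r) ^ 2) with (4 - 4 * r + r * r) by ring.
  replace ((r - 1) ^ 2) with (r * r - 2 * r + 1) by ring.
  rewrite H.
  replace ((1 - t ^ 2) * (t ^ 2 - (4 - 4 * r + 3)) * (t ^ 2 - (3 - 2 * r + 1)))
    with ((1 - t ^ 2) * (t ^ 4 + (6 * r - 11) * t ^ 2 + (28 - 30 * r + 8 * (r * r))))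
    by ring.
  rewrite H; ring.
Qed.

Lemma one_minus_t1_sqr : 1 - t1 ^ 2 = 2 * (2 * sqrt 3 - 3).
Proof. unfold t1; pose proof sqrt3_sqr; nra. Qed.

Lemma one_minus_t2_sqr : 1 - t2 ^ 2 = 2 * sqrt 3 - 3.
Proof. unfold t2; pose proof sqrt3_sqr; nra. Qed.

(** With [w = 1 - t2 ^ 2] one has [1 - t1 ^ 2 = 2 * w], so the quadratic
    factor of [psi] must have the distinct nonzero roots [w] and [2 * w]; this
    fixes it up to its leading coefficient. *)
Lemma zeros_iff_system (phi : R) (q : R * R) :
  psi (cubic phi q) t1 = 0 /\ psi (cubic phi q) t2 = 0 <->
  coefficient_system (cos phi) (sin phi) (bulge_x phi q) (bulge_y phi q).
Proof.
  rewrite !psi_cubic; cbv zeta.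
  rewrite one_minus_t1_sqr, one_minus_t2_sqr; unfold coefficient_system, kappa, mu.
  generalize (cos phi) (sin phi) (bulge_x phi q) (bulge_y phi q); intros c s a b.
  pose proof sqrt3_sqr as H; pose proof sqrt3_bounds as Hr.
  set (r := sqrt 3) in *.
  set (w := 2 * r - 3).
  assert (Hw : w <> 0) by (unfold w; lra).
  assert (Hw2 : w ^ 2 = 21 - 12 * r)
    by (replace (w ^ 2) with (4 * (r * r) - 12 * r + 9) by (unfold w; ring);
        rewrite H; ring).
  split.
  - intros [H1 H2].
    apply Rmult_integral in H1; destruct H1 as [H1|H1]; [lra|].
    apply Rmult_integral in H2; destruct H2 as [H2|H2]; [lra|].
    (* The difference of the two values, divided by w: the sums of the roots
       agree. *)
    assert (E : a ^ 2 - 2 * s * b + b ^ 2 - b ^ 2 * (3 * w) = 0)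
      by (apply (Rmult_eq_reg_l w); [lra|exact Hw]).
    (* The products of the roots agree. *)
    assert (E2 : 2 * a * c + 2 * s * b - s ^ 2 + b ^ 2 * (2 * w ^ 2) = 0) by nra.
    rewrite Hw2 in E2.
    split; [|lra].
    unfold w in E; lra.
  - intros [E1 E2].
    replace (a ^ 2 - 2 * s * b + b ^ 2) with (b ^ 2 * (3 * w))
      by (rewrite E1; unfold w; ring).
    replace (2 * a * c + 2 * s * b - s ^ 2) with (- b ^ 2 * (2 * w ^ 2))
      by (rewrite Hw2, E2; ring).
    split; ring.
Qed.

Lemma psi_of_system (phi : R) (q : R * R) (t : R) :
  coefficient_system (cos phi) (sin phi) (bulge_x phi q) (bulge_y phi q) ->
  psi (cubic phi q) t = - bulge_y phi q ^ 2 * p60 t.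
Proof.
  intros [E1 E2]; rewrite psi_cubic, p60_in_w; cbv zeta.
  rewrite E1, E2; ring.
Qed.

Lemma p60_t1 : p60 t1 = 0.
Proof. unfold p60; ring. Qed.

Lemma p60_t2 : p60 t2 = 0.
Proof. unfold p60; ring. Qed.

Lemma domain_iff (phi : R) (q : R * R) :
  domain_D q <->
  3 / 4 * (1 - cos phi) < bulge_x phi q /\ - sin phi / 4 < bulge_y phi q.
Proof. unfold domain_D, bulge_x, bulge_y; split; intros [? ?]; split; lra. Qed.

(** * Existence and uniqueness of the admissible solution *)

(** If [b <= 0], then [a ^ 2 = b * (2 * s + kappa * b)] would be nonpositive:
    the second factor is positive because [b > - s / 4] and [kappa < 1 / 2]. *)
Lemma system_y_pos (s a b : R) :
  0 < s -> 0 < a -> - s / 4 < b ->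
  a ^ 2 = 2 * s * b + kappa * b ^ 2 -> 0 < b.
Proof.
  intros Hs Ha Hb E; pose proof kappa_bounds.
  apply Rnot_le_lt; intros Hb0.
  assert (0 < a ^ 2) by nra.
  assert (0 <= (- b) * (2 * s + kappa * b)); [|nra].
  apply Rmult_le_pos; nra.
Qed.

(** The first equation makes [a] grow with [b], whereas the second makes
    [2 * a * c] strictly decrease with [b]. *)
Lemma system_unique (c s a b a' b' : R) :
  0 <= c -> 0 < s -> 0 < a -> 0 < b -> 0 < a' -> 0 < b' ->
  coefficient_system c s a b -> coefficient_system c s a' b' ->
  a = a' /\ b = b'.
Proof.
  pose proof kappa_bounds; pose proof mu_bounds.
  assert (L : forall x y x' y', 0 <= c -> 0 < s -> 0 < x -> 0 < y -> 0 < x' ->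
    coefficient_system c s x y -> coefficient_system c s x' y' -> ~ y < y').
  { intros x y x' y' Hc Hs Hx Hy Hx' [E1 E2] [E1' E2'] Hlt.
    assert (Hsq : y ^ 2 < y' ^ 2) by nra.
    assert (x < x') by nra.
    assert (0 <= (x' - x) * c) by (apply Rmult_le_pos; lra).
    nra. }
  intros Hc Hs Ha Hb Ha' Hb' E E'.
  assert (b = b').
  { destruct (Rtotal_order b b') as [Hl|[He|Hg]]; [|exact He|].
    - now elim (L a b a' b').
    - now elim (L a' b' a b). }
  split; [|assumption].
  subst b'; destruct E as [E _], E' as [E' _]; nra.
Qed.

(** The first equation is solved for [a] and put into the second; the resulting
    function of [b] is [- s ^ 2] at [0] and nonnegative at [s / 2]. *)
Lemma system_exists (c s : R) :
  0 <= c -> 0 < s ->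
  exists a b, 0 < a /\ 0 < b /\ coefficient_system c s a b.
Proof.
  intros Hc Hs; pose proof kappa_bounds; pose proof mu_bounds.
  set (A := fun b => sqrt (2 * s * b + kappa * b ^ 2)).
  set (F := fun b => 2 * c * A b + 2 * s * b + mu * b ^ 2 - s ^ 2).
  assert (HF : continuity F).
  { intros b; apply continuity_pt_filterlim.
    change (continuous F b).
    assert (continuous A b).
    { apply (continuous_comp (fun b => 2 * s * b + kappa * b ^ 2) sqrt).
      - apply (ex_derive_continuous (V := R_NormedModule)); auto_derive; exact I.
      - apply continuous_sqrt. }
    apply (continuous_ext
      (fun b => plus (mult (2 * c) (A b)) (2 * s * b + mu * b ^ 2 - s ^ 2))).
    { intros x; unfold F, plus, mult; simpl; ring. }
    apply (continuous_plus (V := R_NormedModule)).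
    - apply (continuous_mult (K := R_AbsRing)); [apply continuous_const|assumption].
    - apply (ex_derive_continuous (V := R_NormedModule)); auto_derive; exact I. }
  assert (F0 : F 0 = - s ^ 2).
  { unfold F, A.
    replace (2 * s * 0 + kappa * 0 ^ 2) with 0 by ring.
    rewrite sqrt_0; ring. }
  destruct (IVT_cor F 0 (s / 2) HF) as [b [Hb Eb]]; [lra| |].
  - assert (0 <= F (s / 2)).
    { unfold F.
      assert (0 <= c * A (s / 2))
        by (apply Rmult_le_pos; [exact Hc|apply sqrt_pos]).
      nra. }
    nra.
  - assert (Hb0 : 0 < b).
    { assert (b <> 0) by (intros ->; nra). lra. }
    assert (Hpos : 0 < 2 * s * b + kappa * b ^ 2).
    { assert (0 < s * b) by (apply Rmult_lt_0_compat; lra). nra. }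
    exists (A b), b.
    split; [now apply sqrt_lt_R0|]; split; [exact Hb0|]; split.
    + unfold A; apply pow2_sqrt; lra.
    + unfold F in Eb; lra.
Qed.

(** The conclusion is the condition [xi > 1].  If it fails, then
    [2 * s * b <= a ^ 2 <= 9 / 16 * (1 - c) ^ 2], and every term of the second
    equation is a multiple of [1 - c]: dividing by it leaves
    [1 + c = s ^ 2 / (1 - c) <= 3 / 2 * c + 9 / 16 * (1 - c)] plus at most
    [81 / 2048], which is impossible for [0 <= c <= 1]. *)
Lemma system_xi_gt_1 (c s a b : R) :
  0 <= c -> 0 < s -> c ^ 2 + s ^ 2 = 1 -> 0 <= a -> 0 <= b ->
  coefficient_system c s a b -> 3 / 4 * (1 - c) < a.
Proof.
  intros Hc Hs Hcs Ha Hb [E1 E2].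
  pose proof kappa_bounds; pose proof mu_bounds.
  apply Rnot_le_lt; intros Hle.
  assert (Hc1 : c < 1) by nra.
  assert (Hs2 : s ^ 2 = (1 - c) * (1 + c)) by lra.
  assert (Hsb : 2 * s * b <= a ^ 2) by nra.
  assert (Ha2 : a ^ 2 <= 9 / 16 * (1 - c) ^ 2) by nra.
  (* This is the square of the bound on 2 s b, divided by 1 - c; the division
     is possible since s^2 = (1 - c) (1 + c). *)
  assert (H4 : 4 * (1 + c) * b ^ 2 <= 81 / 256 * (1 - c) ^ 3).
  { apply (Rmult_le_reg_l (1 - c)); [lra|].
    replace ((1 - c) * (4 * (1 + c) * b ^ 2)) with ((2 * s * b) ^ 2)
      by (rewrite !Rpow_mult_distr, Hs2; ring).
    replace ((1 - c) * (81 / 256 * (1 - c) ^ 3))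
      with ((9 / 16 * (1 - c) ^ 2) ^ 2) by field.
    apply pow_incr; split; nra. }
  assert (H5 : b ^ 2 <= 81 / 1024 * (1 - c)).
  { assert ((1 - c) ^ 3 <= 1 - c).
    { replace ((1 - c) ^ 3) with ((1 - c) * (1 - c) ^ 2) by ring.
      assert ((1 - c) ^ 2 <= 1) by nra. nra. }
    assert (0 <= c * b ^ 2) by (apply Rmult_le_pos; [|apply pow2_ge_0]; lra).
    lra. }
  assert (2 * a * c <= 3 / 2 * (1 - c) * c) by nra.
  assert (mu * b ^ 2 <= 1 / 2 * (81 / 1024 * (1 - c))).
  { apply Rmult_le_compat; try lra; apply pow2_ge_0. }
  nra.
Qed.

Lemma admissible_iff (phi : R) (q : R * R) :
  0 < phi <= PI / 2 ->
  admissible_solution phi q <->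
  0 < bulge_x phi q /\ 0 < bulge_y phi q /\
  coefficient_system (cos phi) (sin phi) (bulge_x phi q) (bulge_y phi q).
Proof.
  intros Hphi.
  assert (Hc : 0 <= cos phi) by (apply cos_ge_0; lra).
  assert (Hs : 0 < sin phi) by (apply sin_gt_0; lra).
  pose proof (cos2_plus_sin2 phi) as Hcs.
  unfold admissible_solution; rewrite zeros_iff_system, (domain_iff phi).
  split.
  - intros [[Hx Hy] E].
    assert (0 < bulge_x phi q) by (pose proof (COS_bound phi); lra).
    split; [assumption|]; split; [|assumption].
    now apply (system_y_pos (sin phi) (bulge_x phi q)); try apply E.
  - intros (Hx & Hy & E); repeat split; try apply E; [|lra].
    apply (system_xi_gt_1 _ (sin phi) _ (bulge_y phi q)); lra || assumption.
Qed.

Lemma admissible_exists_unique (phi : R) :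
  0 < phi <= PI / 2 -> exists q, unique (admissible_solution phi) q.
Proof.
  intros Hphi.
  assert (Hc : 0 <= cos phi) by (apply cos_ge_0; lra).
  assert (Hs : 0 < sin phi) by (apply sin_gt_0; lra).
  destruct (system_exists (cos phi) (sin phi) Hc Hs) as (a & b & Ha & Hb & E).
  set (q := (cos phi + 4 / 3 * a, (sin phi + 4 * b) / 3)).
  assert (Ea : bulge_x phi q = a) by (unfold q, bulge_x; simpl; field).
  assert (Eb : bulge_y phi q = b) by (unfold q, bulge_y; simpl; field).
  exists q; split.
  - apply admissible_iff; [assumption|]; rewrite Ea, Eb; tauto.
  - intros q' Hq'; apply admissible_iff in Hq'; [|assumption].
    destruct Hq' as (Ha' & Hb' & E').
    destruct (system_unique (cos phi) (sin phi) a b (bulge_x phi q') (bulge_y phi q'))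
      as [Ex Ey]; try assumption.
    rewrite <- Ea in Ex; rewrite <- Eb in Ey.
    apply injective_projections; unfold bulge_x, bulge_y in Ex, Ey; lra.
Qed.

(** * The approximants whose error is a multiple of p60 *)

Lemma cubic_G0 (phi : R) (q : R * R) : G0_interpolates phi (cubic phi q).
Proof.
  unfold G0_interpolates, arc; rewrite !cubic_coordinates, cos_neg, sin_neg.
  split; apply injective_projections; simpl; ring.
Qed.

Lemma t1_t2_in_interval : -1 <= t1 <= 1 /\ -1 <= t2 <= 1.
Proof. unfold t1, t2; pose proof sqrt3_bounds; lra. Qed.

Lemma psi_ext (p p' : R -> R * R) (t : R) : p t = p' t -> psi p t = psi p' t.
Proof. intros E; unfold psi; now rewrite E. Qed.

Lemma admissible_optimal (phi : R) (q : R * R) :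
  0 < phi <= PI / 2 -> admissible_solution phi q ->
  optimal_G0_approximant phi (cubic phi q).
Proof.
  intros Hphi Hq; split; [|split].
  - exists q; split; [apply Hq|reflexivity].
  - apply cubic_G0.
  - apply admissible_iff in Hq; [|assumption]; destruct Hq as (_ & Hb & E).
    exists (- bulge_y phi q ^ 2); split; [nra|].
    intros t _; now apply psi_of_system.
Qed.

Lemma optimal_admissible (phi : R) (p : R -> R * R) :
  optimal_G0_approximant phi p ->
  exists q, admissible_solution phi q /\
    forall t, -1 <= t <= 1 -> p t = cubic phi q t.
Proof.
  intros ((q & Hq & Ep) & _ & (k & _ & Hk)).
  exists q; split; [split; [exact Hq|]|exact Ep].
  destruct t1_t2_in_interval as [H1 H2]; split.
  - rewrite <- (psi_ext p) by now apply Ep.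
    rewrite Hk, p60_t1 by exact H1; ring.
  - rewrite <- (psi_ext p) by now apply Ep.
    rewrite Hk, p60_t2 by exact H2; ring.
Qed.

(** * The maximal errors *)

Definition p60_max : R := 2 * (26 - 15 * sqrt 3).

Lemma p60_max_pos : 0 <= p60_max.
Proof. unfold p60_max; pose proof sqrt3_bounds; lra. Qed.

Lemma p60_at_0 : p60 0 = p60_max.
Proof.
  rewrite p60_in_w; unfold kappa, mu, p60_max; ring.
Qed.

(** Centred at [1 - t2 ^ 2] and with [d = 2 - sqrt 3], the polynomial is
    [u ^ 3 - 3 * d ^ 2 * u], a rescaled Chebyshev polynomial of degree 3.  It
    reaches [2 * d ^ 3] and [- 2 * d ^ 3] at the double points [- d] and [d],
    and the interval [0 <= w <= 1] lies inside [-2 * d <= u <= 2 * d]. *)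
Lemma p60_bound (t : R) : -1 <= t <= 1 -> Rabs (p60 t) <= p60_max.
Proof.
  intros Ht; rewrite p60_in_w.
  assert (Hw : 0 <= 1 - t ^ 2 <= 1) by nra.
  set (w := 1 - t ^ 2) in *; clearbody w; clear Ht t.
  pose proof sqrt3_sqr as Hr; pose proof sqrt3_bounds as Br.
  unfold kappa, mu, p60_max; set (r := sqrt 3) in *.
  set (d := 2 - r). set (u := w - r * d).
  assert (Hd : r * d = 2 * r - 3) by (unfold d; nra).
  assert (E : w * (w ^ 2 - (6 * r - 10 + 1) * w + (42 - 24 * r))
              = u ^ 3 - 3 * d ^ 2 * u).
  { unfold u; rewrite Hd; unfold d.
    assert (H2 : r ^ 2 = 3) by nra.
    assert (H3 : r ^ 3 = 3 * r) by nra.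
    ring_simplify; rewrite H3, H2; ring. }
  assert (M : 2 * (26 - 15 * r) = 2 * d ^ 3).
  { unfold d.
    assert (H2 : r ^ 2 = 3) by nra.
    assert (H3 : r ^ 3 = 3 * r) by nra.
    ring_simplify; rewrite H3, H2; ring. }
  rewrite E, M; apply Rabs_le.
  assert (0 <= (u - d) ^ 2 * (u + 2 * d)).
  { apply Rmult_le_pos; [apply pow2_ge_0|]; unfold u; rewrite Hd; unfold d; lra. }
  assert (0 <= (u + d) ^ 2 * (2 * d - u)).
  { apply Rmult_le_pos; [apply pow2_ge_0|]; unfold u; rewrite Hd; unfold d; lra. }
  split; nra.
Qed.

Definition psi_max (phi : R) (q : R * R) : R := bulge_y phi q ^ 2 * p60_max.

Lemma psi_max_spec (phi : R) (q : R * R) :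
  coefficient_system (cos phi) (sin phi) (bulge_x phi q) (bulge_y phi q) ->
  is_max_on (fun t => Rabs (psi (cubic phi q) t)) (-1) 1 (psi_max phi q).
Proof.
  intros E.
  assert (Habs : forall t,
    Rabs (psi (cubic phi q) t) = bulge_y phi q ^ 2 * Rabs (p60 t)).
  { intros t; rewrite (psi_of_system phi q t E), Rabs_mult, Rabs_Ropp.
    rewrite (Rabs_pos_eq (bulge_y phi q ^ 2)) by apply pow2_ge_0; reflexivity. }
  pose proof p60_max_pos as Hm.
  unfold psi_max; split.
  - exists 0; split; [lra|].
    rewrite Habs, p60_at_0, (Rabs_pos_eq p60_max) by exact Hm; reflexivity.
  - intros t Ht; rewrite Habs.
    apply Rmult_le_compat_l; [apply pow2_ge_0|now apply p60_bound].
Qed.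

Definition radial_max (phi : R) (q : R * R) : R := 1 - sqrt (1 - psi_max phi q).

(** If [|n ^ 2 - 1| <= e] then [n] is at most as far from [1] as
    [sqrt (1 - e)]: the lower bound is direct, and the upper bound
    [n <= 2 - sqrt (1 - e)] is the concavity of the square root. *)
Lemma radial_max_spec (phi : R) (q : R * R) :
  coefficient_system (cos phi) (sin phi) (bulge_x phi q) (bulge_y phi q) ->
  is_max_on (fun t => Rabs (radial_distance (cubic phi q) t)) (-1) 1
    (radial_max phi q).
Proof.
  intros E.
  pose proof p60_max_pos as Hm.
  assert (H0 : psi (cubic phi q) 0 = - psi_max phi q).
  { rewrite (psi_of_system phi q 0 E), p60_at_0; unfold psi_max; ring. }
  assert (Hpos : 0 <= psi_max phi q)
    by (apply Rmult_le_pos; [apply pow2_ge_0|exact Hm]).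
  destruct (psi_max_spec phi q E) as [_ Hle].
  unfold radial_max, radial_distance.
  set (e := psi_max phi q) in *.
  (* The error is most negative at t = 0, where the maximum is attained. *)
  assert (N0 : norm (cubic phi q 0) = sqrt (1 - e)).
  { rewrite <- (sqrt_pow2 (norm (cubic phi q 0))) by apply norm_ge_0.
    f_equal; unfold psi in H0; lra. }
  assert (He : 0 <= 1 - e).
  { unfold psi in H0; pose proof (pow2_ge_0 (norm (cubic phi q 0))); lra. }
  pose proof (sqrt_pos (1 - e)) as Hs.
  pose proof (pow2_sqrt _ He) as Hs2.
  set (s := sqrt (1 - e)) in *.
  assert (s <= 1) by nra.
  split.
  - exists 0; split; [lra|].
    rewrite N0, Rabs_left1; lra.
  - intros t Ht; specialize (Hle t Ht); cbv beta in Hle.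
    apply Rabs_le_between in Hle; unfold psi in Hle.
    pose proof (norm_ge_0 (cubic phi q t)) as Hn.
    apply Rabs_le.
    set (n := norm (cubic phi q t)) in *.
    split; nra.
Qed.

(** * Asymptotics *)

(** The second equation gives [a <= s ^ 2] because [2 * c >= 1]; the first then
    gives [2 * b <= s ^ 3].  With these bounds all terms but the leading ones
    are of higher order in [s], and each equation can be used once more to get
    the leading coefficient with an error term. *)
Lemma system_expansion (c s a b : R) :
  1 / 2 <= c -> 0 < s -> c ^ 2 + s ^ 2 = 1 -> 0 < a -> 0 < b ->
  coefficient_system c s a b -> Rabs (64 * b ^ 2 - s ^ 6) <= 70 * s ^ 8.
Proof.
  intros Hc Hs Hcs Ha Hb [E1 E2].
  pose proof kappa_bounds as Hk; pose proof mu_bounds as Hm.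
  assert (0 < s * b) by (apply Rmult_lt_0_compat; assumption).
  assert (Hb2 : 0 < b ^ 2) by nra.
  assert (Hmb : 0 < mu * b ^ 2 <= 1 / 2 * b ^ 2) by nra.
  assert (Hkb : 0 < kappa * b ^ 2 <= 1 / 2 * b ^ 2) by nra.
  assert (Hs1 : s ^ 2 <= 1) by nra.
  assert (Has : a <= s ^ 2) by nra.
  assert (Hbs : 2 * b <= s ^ 3).
  { apply (Rmult_le_reg_l s); [lra|].
    apply Rle_trans with (a ^ 2); [lra|].
    replace (s * s ^ 3) with ((s ^ 2) ^ 2) by ring. apply pow_incr; lra. }
  assert (Hb6 : 4 * b ^ 2 <= s ^ 6).
  { replace (4 * b ^ 2) with ((2 * b) ^ 2) by ring.
    replace (s ^ 6) with ((s ^ 3) ^ 2) by ring. apply pow_incr; lra. }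
  assert (Hs64 : s ^ 6 <= s ^ 4).
  { replace (s ^ 6) with (s ^ 4 * s ^ 2) by ring.
    assert (0 < s ^ 4) by now apply pow_lt. nra. }
  assert (Hc1 : 0 <= 1 - c <= s ^ 2) by nra.
  assert (Hac : 0 <= a * (1 - c) <= s ^ 4).
  { split; [apply Rmult_le_pos; lra|].
    replace (s ^ 4) with (s ^ 2 * s ^ 2) by ring.
    apply Rmult_le_compat; lra. }
  assert (Hsb : 2 * s * b <= s ^ 4).
  { replace (s ^ 4) with (s * s ^ 3) by ring. nra. }
  (* The second equation reads
     2 a - s^2 = 2 a (1 - c) - 2 s b - mu b^2. *)
  assert (D1 : - 2 * s ^ 4 <= 2 * a - s ^ 2 <= 2 * s ^ 4) by lra.
  assert (D2 : - 6 * s ^ 6 <= 4 * a ^ 2 - s ^ 4 <= 6 * s ^ 6).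
  { replace (4 * a ^ 2 - s ^ 4) with ((2 * a - s ^ 2) * (2 * a + s ^ 2)) by ring.
    assert (0 < 2 * a + s ^ 2 <= 3 * s ^ 2) by nra.
    assert (0 < s ^ 4) by now apply pow_lt.
    assert (2 * s ^ 4 * (2 * a + s ^ 2) <= 6 * s ^ 6).
    { replace (6 * s ^ 6) with (2 * s ^ 4 * (3 * s ^ 2)) by ring.
      apply Rmult_le_compat_l; lra. }
    split; nra. }
  assert (D3 : - 7 * s ^ 5 <= 8 * b - s ^ 3 <= 7 * s ^ 5).
  { assert (D : - 7 * s ^ 6 <= s * (8 * b - s ^ 3) <= 7 * s ^ 6).
    { replace (s * (8 * b - s ^ 3))
        with (4 * a ^ 2 - s ^ 4 - 4 * (kappa * b ^ 2))
        by (rewrite E1; ring). lra. }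
    split; apply (Rmult_le_reg_l s); lra. }
  replace (64 * b ^ 2 - s ^ 6) with ((8 * b - s ^ 3) * (8 * b + s ^ 3)) by ring.
  replace (70 * s ^ 8) with (7 * s ^ 5 * (10 * s ^ 3)) by ring.
  rewrite Rabs_mult; apply Rmult_le_compat; try apply Rabs_pos;
    apply Rabs_le; split; lra.
Qed.

(** From [x - x ^ 3 / 6 <= sin x <= x] and the factorization of a difference of
    sixth powers: each of the six terms of the cofactor is at most [x ^ 5]. *)
Lemma sin_pow6_expansion (x : R) : 0 < x <= 1 -> Rabs (sin x ^ 6 - x ^ 6) <= x ^ 8.
Proof.
  intros Hx.
  assert (HPI : 3 < PI) by (pose proof PI2_3_2; lra).
  destruct (sin_bound x 0) as [Hlo _]; [lra|lra|].
  unfold sin_approx, sin_term in Hlo; simpl in Hlo.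
  assert (Hs : sin x < x) by (apply sin_lt_x; lra).
  assert (Hs0 : 0 < sin x) by (apply sin_gt_0; lra).
  set (s := sin x) in *.
  assert (Hd : 0 <= x - s <= x ^ 3 / 6) by (split; nra).
  rewrite Rabs_left1.
  2:{ assert (s ^ 6 <= x ^ 6) by (apply pow_incr; lra). lra. }
  assert (H : forall n, 0 <= s ^ n <= x ^ n)
    by (intros n; split; [apply pow_le; lra|apply pow_incr; lra]).
  assert (P : forall i j, s ^ i * x ^ j <= x ^ (i + j)).
  { intros i j; rewrite pow_add; apply Rmult_le_compat_r; [apply pow_le; lra|apply H]. }
  replace (- (s ^ 6 - x ^ 6)) with
    ((x - s) * (s ^ 0 * x ^ 5 + s ^ 1 * x ^ 4 + s ^ 2 * x ^ 3 + s ^ 3 * x ^ 2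
       + s ^ 4 * x ^ 1 + s ^ 5 * x ^ 0)) by ring.
  replace (x ^ 8) with (x ^ 3 / 6 * (6 * x ^ 5)) by field.
  pose proof (P 0 5)%nat; pose proof (P 1 4)%nat; pose proof (P 2 3)%nat.
  pose proof (P 3 2)%nat; pose proof (P 4 1)%nat; pose proof (P 5 0)%nat.
  cbn [Nat.add] in *.
  apply Rmult_le_compat; try lra.
  repeat apply Rplus_le_le_0_compat; apply Rmult_le_pos; apply pow_le; lra.
Qed.

Lemma at_right_0_interval (P : R -> Prop) :
  (forall x, 0 < x <= 1 -> P x) -> at_right 0 P.
Proof.
  intros H; exists (mkposreal 1 Rlt_0_1); intros y Hy Hy0.
  apply H; split; [exact Hy0|].
  change (Rabs (y - 0) < 1) in Hy; apply Rabs_lt_between in Hy; lra.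
Qed.

(** [psi_max] is [(26 - 15 * sqrt 3) / 32] times [64 * b ^ 2], and
    [64 * b ^ 2] is [phi ^ 6] up to [71 * phi ^ 8]; the factor is less than
    [1 / 1000]. *)
Lemma psi_max_asymptotics (phi : R) (q : R * R) :
  0 < phi <= 1 -> admissible_solution phi q ->
  Rabs (psi_max phi q - 1 / 32 * (26 - 15 * sqrt 3) * phi ^ 6) <= phi ^ 8.
Proof.
  intros Hphi Hq.
  assert (HPI : 3 < PI) by (pose proof PI2_3_2; lra).
  apply admissible_iff in Hq; [|lra]; destruct Hq as (Ha & Hb & E).
  assert (Hs : 0 < sin phi < phi)
    by (split; [apply sin_gt_0|apply sin_lt_x]; lra).
  assert (Hc : 1 / 2 <= cos phi).
  { rewrite <- cos_PI3; apply cos_decr_1; lra. }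
  pose proof (cos2_plus_sin2 phi) as Hcs.
  pose proof (system_expansion _ _ _ _ Hc (proj1 Hs) Hcs Ha Hb E) as H1.
  pose proof (sin_pow6_expansion phi Hphi) as H2.
  assert (H3 : sin phi ^ 8 <= phi ^ 8) by (apply pow_incr; lra).
  unfold psi_max, p60_max; pose proof sqrt3_bounds.
  apply Rabs_le_between in H1; apply Rabs_le_between in H2; apply Rabs_le.
  set (b2 := bulge_y phi q ^ 2) in *; set (r := sqrt 3) in *.
  replace (b2 * (2 * (26 - 15 * r)) - 1 / 32 * (26 - 15 * r) * phi ^ 6)
    with ((26 - 15 * r) / 32 * (64 * b2 - phi ^ 6)) by field.
  assert (Hd : - (71 * phi ^ 8) <= 64 * b2 - phi ^ 6 <= 71 * phi ^ 8) by lra.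
  assert (0 < (26 - 15 * r) / 32 < 1 / 1000) by lra.
  split; nra.
Qed.

Lemma one_minus_sqrt_expansion (e : R) :
  0 <= e <= 1 -> Rabs (1 - sqrt (1 - e) - e / 2) <= e ^ 2.
Proof.
  intros He.
  assert (Hs2 : sqrt (1 - e) ^ 2 = 1 - e) by (apply pow2_sqrt; lra).
  pose proof (sqrt_pos (1 - e)) as Hs; set (s := sqrt (1 - e)) in *.
  assert (s <= 1) by nra.
  replace e with (1 - s ^ 2) by lra.
  replace (1 - s - (1 - s ^ 2) / 2) with ((1 - s) ^ 2 / 2) by field.
  replace ((1 - s ^ 2) ^ 2) with ((1 - s) ^ 2 * (1 + s) ^ 2) by ring.
  pose proof (pow2_ge_0 (1 - s)).
  rewrite Rabs_pos_eq by lra. nra.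
Qed.

(** The radial error differs from half of the maximum of [|psi|] by at most the
    square of that maximum, which is of order [phi ^ 12]. *)
Lemma radial_max_asymptotics (phi : R) (q : R * R) :
  0 < phi <= 1 -> admissible_solution phi q ->
  Rabs (radial_max phi q - 1 / 64 * (26 - 15 * sqrt 3) * phi ^ 6)
  <= 5 * phi ^ 8.
Proof.
  intros Hphi Hq.
  pose proof (psi_max_asymptotics phi q Hphi Hq) as H1.
  pose proof sqrt3_bounds as Hr.
  assert (He0 : 0 <= psi_max phi q)
    by (apply Rmult_le_pos; [apply pow2_ge_0|exact p60_max_pos]).
  assert (HPI : 3 < PI) by (pose proof PI2_3_2; lra).
  (* 1 - psi_max is the squared norm of the curve at t = 0. *)
  assert (He1 : psi_max phi q <= 1).
  { apply admissible_iff in Hq; [|lra]; destruct Hq as (_ & _ & E).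
    pose proof (psi_of_system phi q 0 E) as H0; rewrite p60_at_0 in H0.
    unfold psi in H0; unfold psi_max.
    pose proof (pow2_ge_0 (norm (cubic phi q 0))); lra. }
  pose proof (one_minus_sqrt_expansion _ (conj He0 He1)) as H2.
  unfold radial_max; set (e := psi_max phi q) in *; set (r := sqrt 3) in *.
  assert (H86 : 0 <= phi ^ 8 <= phi ^ 6).
  { replace (phi ^ 8) with (phi ^ 6 * phi ^ 2) by ring.
    assert (0 < phi ^ 6) by (apply pow_lt; lra).
    assert (0 <= phi ^ 2 <= 1) by nra. nra. }
  apply Rabs_le_between in H1.
  assert (He : e <= 2 * phi ^ 6) by nra.
  assert (He2 : e ^ 2 <= 4 * phi ^ 8).
  { apply Rle_trans with ((2 * phi ^ 6) ^ 2); [apply pow_incr; lra|].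
    replace ((2 * phi ^ 6) ^ 2) with (4 * phi ^ 8 * phi ^ 4) by ring.
    assert (phi ^ 4 <= 1 ^ 4) by (apply pow_incr; lra). nra. }
  apply Rabs_le_between in H2; apply Rabs_le; lra.
Qed.

Theorem theorem5 :
  exists q : R -> R * R,
    (forall phi : R, 0 < phi <= PI / 2 ->
       unique (admissible_solution phi) (q phi) /\
       optimal_G0_approximant phi (cubic phi (q phi)) /\
       (forall p : R -> R * R, optimal_G0_approximant phi p ->
          forall t : R, -1 <= t <= 1 -> p t = cubic phi (q phi) t)) /\
    (exists M : R -> R,
       (forall phi : R, 0 < phi <= PI / 2 ->
          is_max_on (fun t => Rabs (psi (cubic phi (q phi)) t)) (-1) 1 (M phi)) /\
       bigO_right0
         (fun phi => M phi - 1 / 32 * (26 - 15 * sqrt 3) * phi ^ 6)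
         (fun phi => phi ^ 8)) /\
    (exists M : R -> R,
       (forall phi : R, 0 < phi <= PI / 2 ->
          is_max_on (fun t => Rabs (radial_distance (cubic phi (q phi)) t)) (-1) 1 (M phi)) /\
       bigO_right0
         (fun phi => M phi - 1 / 64 * (26 - 15 * sqrt 3) * phi ^ 6)
         (fun phi => phi ^ 8)) /\
    Rabs (1 / 64 * (26 - 15 * sqrt 3) - 3 / 10000) < 5 / 100000.
Proof.
  set (q := fun phi => epsilon (inhabits (0, 0)) (unique (admissible_solution phi))).
  assert (Hq : forall phi, 0 < phi <= PI / 2 ->
    unique (admissible_solution phi) (q phi)).
  { intros phi Hphi; apply epsilon_spec; now apply admissible_exists_unique. }
  assert (Hsys : forall phi, 0 < phi <= PI / 2 -> coefficient_system
    (cos phi) (sin phi) (bulge_x phi (q phi)) (bulge_y phi (q phi))).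
  { intros phi Hphi; apply zeros_iff_system; apply (Hq phi Hphi). }
  assert (Hsmall : forall phi, 0 < phi <= 1 -> admissible_solution phi (q phi)).
  { intros phi Hphi; apply Hq; pose proof PI2_3_2; lra. }
  exists q; split; [|split; [|split]].
  - intros phi Hphi; split; [now apply Hq|split].
    + now apply admissible_optimal; [|apply Hq].
    + intros p Hp t Ht.
      destruct (optimal_admissible phi p Hp) as (q' & Hq' & Ep).
      rewrite (proj2 (Hq phi Hphi) q' Hq'); now apply Ep.
  - exists (fun phi => psi_max phi (q phi)); split.
    + intros phi Hphi; apply psi_max_spec; auto.
    + exists 1; apply at_right_0_interval; intros phi Hphi.
      rewrite (Rabs_pos_eq (phi ^ 8)) by (apply pow_le; lra).
      rewrite Rmult_1_l; apply psi_max_asymptotics; auto.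
  - exists (fun phi => radial_max phi (q phi)); split.
    + intros phi Hphi; apply radial_max_spec; auto.
    + exists 5; apply at_right_0_interval; intros phi Hphi.
      rewrite (Rabs_pos_eq (phi ^ 8)) by (apply pow_le; lra).
      apply radial_max_asymptotics; auto.
  - apply Rabs_lt_between; pose proof sqrt3_bounds; lra.
Qed.
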